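(* Let $T$ be a tree with $n$ vertices. The algorithm TREE-INDEPENDENT $[1,2]$-SET, described explicitly in the context, decides in $O(n)$ time whether or not $T$ has an independent $[1,2]$-set.
   Context: All graphs are finite, undirected, simple and connected. For a graph $G=(V,E)$ and $v\in V$, $N(v)$ is the set of neighbors of $v$ and $N[v]=N(v)\cup\{v\}$. A set $S\subseteq V$ is an independent $[1,2]$-set of $G$ if no two vertices of $S$ are adjacent and every $v\in V\setminus S$ satisfies $1\le |N(v)\cap S|\le 2$. A leaf is a vertex of degree one, an internal vertex is a non-leaf vertex, and a support vertex is a vertex having a leaf as neighbor. Labels. Let $G$ have at least two vertices and $v\in V(G)$. An independent set $S\subseteq V(G)$ is of type I for $v$ in $G$ if every vertex $u\in V(G)\setminus(S\cup\{v\})$ has at least one and at most two neighbors in $S$, and $v$ either is in $S$ or is not in $S$ and has zero, one or two neighbors in $S$. For such $S$, the label $L_S(v)$ is: $0$ if $v\in S$; $k$ if $v\notin S$ and $v$ has $k\ge 1$ neighbors in $S$; $-1$ if $N[v]\cap S=\emptyset$ and every neighbor of $v$ has exactly one neighbor in $S$; $-2$ if $N[v]\cap S=\emptyset$ and some neighbor of $v$ has two neighbors in $S$. The list $R(v)$ used by the algorithm records the possible labels of $v$ for type I sets for $v$ in the part of the subtree rooted at $v$ processed so far (at the end of the processing of $v$, in the whole subtree rooted at $v$). Update rules. (Star rule) For the star with center $v$ and $r\ge1$ leaves, the labels of $v$ are: $\{0\}$ if $r\ge 3$; $\{0,2\}$ if $r=2$; $\{0,1\}$ if $r=1$. (One-vertex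 rule) When a single new vertex $v$ is joined by an edge to the vertex $u$ of a graph with at least two vertices, each label $a$ of $u$ produces the following labels of $v$: $a=2$ gives $-2$; $a=1$ gives $-1$ and $0$; $a=0$ gives $1$; $a=-1$ gives $0$ and $1$; $a=-2$ gives $0$. (Two-graph rule) When a graph containing $u$ and a graph containing $v$, each with at least two vertices, are joined by the edge $uv$, the pairs (label $a$ of $u$, label $b$ of $v$) produce the following new labels of $v$: label $-2$ from $(1,-2),(2,-2),(2,-1)$; label $-1$ from $(1,-1)$; label $0$ from $(-2,0),(-1,0),(1,0),(-2,-1),(-1,-1),(1,-1)$; label $1$ from $(0,-2),(0,-1),(1,1),(2,1),(-1,-2),(-1,-1)$; label $2$ from $(0,1),(1,2),(2,2),(-1,1)$; no other pair produces a label, and a pair listed several times produces each of the corresponding labels. Algorithm TREE-INDEPENDENT $[1,2]$-SET. Input: a tree $T$; let $m$ be its number of internal vertices. Output: whether or not $T$ admits an independent $[1,2]$-set. 1. Choose a non-leaf vertex as the root. Index the internal vertices by different labels $i(\cdot)\in\{1,\dots,m\}$ so that $i(u)<i(v)$ whenever $u$ is a descendant of $v$ (so the root has index $m$). Initialize $R(u)$ as the empty list for each vertex $u$. 2. For $i=1,\dots,m$, let $v$ be the vertex with $i(v)=i$ and do the following. (a) If $v$ is a support vertex: apply the star rule to the star with center $v$ and its descendant leaves (its leaf children) to set $R(v)$; then, for each non-leaf child $u$ of $v$, apply the two-graph rule to $R(u)$ and the current $R(v)$ and update $R(v)$ to the resulting set of labels. (b) If $v$ is not a support vertex: pick one child $u$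 of $v$ and apply the one-vertex rule to $R(u)$ to set $R(v)$; then, for each of the remaining children $u$ of $v$, apply the two-graph rule to $R(u)$ and the current $R(v)$ and update $R(v)$ to the resulting set of labels. (c) If $R(v)=\emptyset$, answer NO and end. 3. If $R(v)\cap\{0,1,2\}=\emptyset$ for the root $v$, answer NO; otherwise answer YES. End. *)

(* Defs.v *)
From mathcomp Require Import all_boot all_algebra.

Set Implicit Arguments.
Unset Strict Implicit.
Unset Printing Implicit Defensive.

Definition acyclic (V : finType) (e : rel V) : Prop :=
  forall c : seq V, 2 < size c -> ~ ucycle e c.

Definition tree (V : finType) (e : rel V) : Prop :=
  [/\ 0 < #|V|, symmetric e, irreflexive e,
      (forall x y, connect e x y) & acyclic e].

Definition neighbors (V : finType) (e : rel V) (v : V) : {set V} :=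
  [set u | e v u].

Definition independent_12_set (V : finType) (e : rel V) (S : {set V}) : Prop :=
  {in S &, forall u v, ~~ e u v} /\
  (forall v, v \notin S -> 1 <= #|neighbors e v :&: S| <= 2).

(* The input of the algorithm: the list of the vertices and an array of
   adjacency lists, each without repetitions and in an arbitrary order. *)
Definition vertex_list (V : finType) (vs : seq V) : Prop :=
  uniq vs /\ forall v, v \in vs.

Definition adjacency_lists (V : finType) (e : rel V) (adj : V -> seq V) : Prop :=
  forall v, uniq (adj v) /\ adj v =i e v.

(* Running time is counted in the unit-cost RAM model. A computation returns
   its result together with the number of steps it made, and a step is a bounded
   number of elementary operations: reading or writing an array cell, matching
   a list on its first cells, adding a cell to a list, comparing or
   incrementing machine words, consulting a table of fixed size. Vertices and
   labels are machine words. A function with domain V stands for an array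
   indexed by the vertices. *)
Definition timed (A : Type) : Type := (A * nat)%type.

Definition step A (a : A) : timed A := (a, 1).

Definition bind A B (m : timed A) (k : A -> timed B) : timed B :=
  let r := k m.1 in (r.1, m.2 + r.2).

Notation "'let!' x ':=' m 'in' k" := (bind m (fun x => k))
  (at level 200, x strict pattern, m at level 200, k at level 200,
   format "'[v' 'let!'  x  ':='  m  'in' '/' k ']'").

(* Every test of the loop condition counts for one step. *)
Fixpoint for_each X S (xs : seq X) (body : X -> S -> timed S) (s : S) : timed S :=
  if xs is x :: xs' then
    let! s1 := body x s in
    let! s2 := step s1 in
    for_each xs' body s2
  else step s.

Definition write (V : finType) A (f : V -> A) (v : V) (a : A) : V -> A :=
  fun u => if u == v then a else f u.

(* Creation of an array all of whose cells contain a: one step per cell. *)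
Definition new_array (V : finType) A (vs : seq V) (a : A) : timed (V -> A) :=
  for_each vs (fun v f => step (write f v a)) (fun=> a).

Definition one_vertex_table : seq (int * seq int) :=
  [:: ( 2, [:: -2]);
      ( 1, [:: -1; 0]);
      ( 0, [:: 1]);
      (-1, [:: 0; 1]);
      (-2, [:: 0])]%Z.

(* Each new label of v, with the pairs (label of u, label of v) producing it. *)
Definition two_graph_table : seq (int * seq (int * int)) :=
  [:: (-2, [:: (1, -2); (2, -2); (2, -1)]);
      (-1, [:: (1, -1)]);
      ( 0, [:: (-2, 0); (-1, 0); (1, 0); (-2, -1); (-1, -1); (1, -1)]);
      ( 1, [:: (0, -2); (0, -1); (1, 1); (2, 1); (-1, -2); (-1, -1)]);
      ( 2, [:: (0, 1); (1, 2); (2, 2); (-1, 1)])]%Z.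

Definition one_vertex_labels (a : int) : seq int :=
  flatten [seq r.2 | r <- one_vertex_table & r.1 == a].

Definition two_graph_labels (a b : int) : seq int :=
  [seq r.1 | r <- two_graph_table & (a, b) \in r.2].

(* Label sets are lists without repetitions. *)
Definition add_label (c : int) (L : seq int) : timed (seq int) :=
  let! found := for_each L (fun b found => step (found || (b == c))) false in
  step (if found then L else c :: L).

Definition star_rule (r : nat) : timed (seq int) :=
  step (if 3 <= r then [:: 0%Z]
        else if r == 2 then [:: 0%Z; 2%Z] else [:: 0%Z; 1%Z]).

Definition one_vertex_rule (A : seq int) : timed (seq int) :=
  for_each A (fun a L =>
    let! cs := step (one_vertex_labels a) in
    for_each cs add_label L) [::].

Definition two_graph_rule (A B : seq int) : timed (seq int) :=
  for_each A (fun a L =>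
    for_each B (fun b L =>
      let! cs := step (two_graph_labels a b) in
      for_each cs add_label L) L) [::].

Definition is_leaf (V : finType) (adj : V -> seq V) (v : V) : timed bool :=
  step (if adj v is [:: _] then true else false).

Definition is_support (V : finType) (adj : V -> seq V) (v : V) : timed bool :=
  for_each (adj v) (fun u found =>
    let! leaf := is_leaf adj u in
    step (found || leaf)) false.

Fixpoint find_non_leaf (V : finType) (adj : V -> seq V) (vs : seq V)
    : timed (option V) :=
  if vs is v :: vs' then
    let! leaf := is_leaf adj v in
    if leaf then find_non_leaf adj vs' else step (Some v)
  else step None.

(* par maps every non-root vertex to its parent. *)
Definition children (V : finType) (adj : V -> seq V) (par : V -> option V)
    (v : V) : timed (seq V) :=
  for_each (adj v) (fun u us =>
    step (if par v == Some u then us else u :: us)) [::].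

(* A choice made by the algorithm: a position in the list x :: s. *)
Definition chooser (V : finType) : Type :=
  forall (x : V) (s : seq V), 'I_(size s).+1.

(* Indexing of the internal vertices, from the root (index m) downwards. The
   bag holds the internal vertices not yet indexed whose parent is indexed; the
   next smaller index goes to any one of them, at the discretion of pick, so
   every indexing in which descendants come before their ancestors arises for
   some pick. The list ord is the internal vertices indexed so far, by
   increasing index. The bag is an array whose top cell is the head of the
   list: the chosen cell is overwritten with the top one, which is then
   dropped. The loop makes at most as many rounds as there are vertices. *)
Fixpoint index_internal (V : finType) (adj : V -> seq V) (pick : chooser V)
    (rounds : seq V) (par : V -> option V) (ord bag : seq V)
    : timed ((V -> option V) * seq V) :=
  match rounds, bag with
  | _ :: rounds', x :: s =>
      let! v := step (nth x bag (pick x s)) in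
      let! rest := step (behead (set_nth x bag (pick x s) x)) in
      let! us := children adj par v in
      let! (par', bag') := for_each us (fun u pb =>
          let! par1 := step (write pb.1 u (Some v)) in
          let! leaf := is_leaf adj u in
          step (par1, if leaf then pb.2 else u :: pb.2)) (par, rest) in
      index_internal adj pick rounds' par' (v :: ord) bag'
  | _, _ => step (par, ord)
  end.

(* Number of leaves in us, and the other elements of us. *)
Definition split_leaves (V : finType) (adj : V -> seq V) (us : seq V)
    : timed (nat * seq V) :=
  for_each us (fun u ru =>
    let! leaf := is_leaf adj u in
    step (if leaf then (ru.1.+1, ru.2) else (ru.1, u :: ru.2))) (0, [::]).

Definition join_children (V : finType) (R : V -> seq int) (us : seq V)
    (L : seq int) : timed (seq int) :=
  for_each us (fun u L =>
    let! A := step (R u) in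
    two_graph_rule A L) L.

Definition process_vertex (V : finType) (adj : V -> seq V)
    (par : V -> option V) (R : V -> seq int) (v : V) : timed (seq int) :=
  let! us := children adj par v in
  let! support := is_support adj v in
  if support then
    let! (r, ws) := split_leaves adj us in
    let! L := star_rule r in
    join_children R ws L
  else if us is u :: us' then
    let! A := step (R u) in
    let! L := one_vertex_rule A in
    join_children R us' L
  else step [::].

(* None: the answer NO was given because some R(v) was empty. *)
Fixpoint process_all (V : finType) (adj : V -> seq V) (par : V -> option V)
    (ord : seq V) (R : V -> seq int) : timed (option (V -> seq int)) :=
  if ord is v :: ord' then
    let! L := process_vertex adj par R v in
    if L is [::] then step None
    else
      let! R' := step (write R v L) in
      process_all adj par ord' R'
  else step (Some R).

(* The result true stands for YES. The algorithm needs a non-leaf root with at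
   least one child, that is, at least three vertices; the trees with one or two
   vertices are answered directly (any one vertex is an independent
   [1,2]-set). *)
Definition tree_independent_12_set (V : finType) (adj : V -> seq V)
    (pick : chooser V) (vs : seq V) : timed bool :=
  if vs is [:: _, _, _ & _] then
    let! root := find_non_leaf adj vs in
    if root is Some r then
      let! par0 := new_array vs None in
      let! (par, ord) := index_internal adj pick vs par0 [::] [:: r] in
      let! R0 := new_array vs [::] in
      let! res := process_all adj par ord R0 in
      if res is Some R then
        for_each (R r) (fun a yes => step (yes || (a \in [:: 0; 1; 2]%Z))) false
      else step false
    else step false
  else step true.

(* Main.v *)
Require Import Defs.
From mathcomp Require Import all_boot all_algebra.
From mathcomp Require Import zify.

Set Implicit Arguments.
Unset Strict Implicit.
Unset Printing Implicit Defensive.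

(** The algorithm is a dynamic programming over the rooted tree. A set that is to
    be an independent [1,2]-set of the whole tree restricts, on the subtree of a
    vertex v, to a type I set for v: every vertex but v has all its neighbours
    inside the subtree. What the rest of the tree needs to know about this
    restriction is only the label of v. Correctness therefore means that R(v) is
    the set of all labels of v for type I sets in its subtree, which for the root
    decides the question (independent_label).

    When two graphs are joined by an edge uv, a type I set of the result is the
    union of its two sides, and whether two sides fit, and the label that results,
    depend only on the labels of u and v (type_I_join, compatibleP, label_join).
    A finite check compares this with the two-graph table (lists_labels_join). A
    single vertex has the labels -1 and 0, and with this starting point the
    one-vertex rule and the star rule become iterations of the two-graph rule
    (one_vertex_labelsE, star_labelsS), so that one lemma, lists_labels_cons,
    covers all the updates.

    The subtree of v is the component of v after removing the edge to its parent
    (branch). It is v together with the subtrees of its children, pairwise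
    disjoint and attached by one edge each (branchE, branch_disjoint,
    branch_exit), because every edge of a tree is a bridge (branch_parent). The
    parent of a vertex is determined by the root alone (rooted_uniq); hence the
    vertices pushed to the bag are always new, the indexing reaches each internal
    vertex once, and children come before parents (indexing_state_step).

    A label list has at most five entries, so joining a child costs a bounded
    number of steps and processing v costs at most a constant times its degree
    plus one, as does indexing it. The degrees of a tree add up to at most twice
    the number of vertices (sum_degrees), which makes the total linear. *)

(** * Computations with a bound on their running time *)

(** A Hoare triple for the cost model: the bound on the number of steps and the
    postcondition are proved together, because the bounds on the label loops
    rest on the lists being repetition-free. *)
Definition within A (t : nat) (m : timed A) (P : A -> Prop) : Prop :=
  m.2 <= t /\ P m.1.

Lemma within_bind A B t1 t2 (m : timed A) (k : A -> timed B) P Q :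
  within t1 m P -> (forall a, P a -> within t2 (k a) Q) ->
  within (t1 + t2) (bind m k) Q.
Proof.
move=> [t1m Pm] kQ; have [t2k Qk] := kQ _ Pm.
by split; rewrite //= leq_add.
Qed.

Lemma within_step A (a : A) (P : A -> Prop) : P a -> within 1 (step a) P.
Proof. by []. Qed.

Lemma within_impl A t1 t2 (m : timed A) (P Q : A -> Prop) :
  t1 <= t2 -> (forall a, P a -> Q a) -> within t1 m P -> within t2 m Q.
Proof. by move=> le12 PQ [t1m Pm]; split; [apply: leq_trans le12|apply: PQ]. Qed.

(** The invariant sees the elements already treated. A round costs one step more
    than its body, for the test of the loop condition, and the last test ends
    the loop. *)
Lemma within_for_each X S t (I : seq X -> S -> Prop) (body : X -> S -> timed S)
    xs s :
  I [::] s ->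
  (forall done x rest s', xs = done ++ x :: rest -> I done s' ->
     within t (body x s') (I (rcons done x))) ->
  within (t.+1 * size xs).+1 (for_each xs body s) (I xs).
Proof.
move=> I0 Ibody.
suff: forall rest done s', xs = done ++ rest -> I done s' ->
    within (t.+1 * size rest).+1 (for_each rest body s') (I xs).
  by move=> H; apply: (H _ [::]).
elim=> [|x rest IH] done s' Exs Is'; first by rewrite Exs cats0.
apply: (@within_impl _ (t + (1 + (t.+1 * size rest).+1)) _ _ (I xs)) => //=.
  by lia.
apply: within_bind (Ibody _ _ _ _ Exs Is') _ => s1 Is1.
apply: within_bind (within_step Is1) _ => s2 Is2.
by apply: IH Is2; rewrite cat_rcons.
Qed.

Lemma within_for_each_le X S n t (I : seq X -> S -> Prop)
    (body : X -> S -> timed S) xs s :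
  size xs <= n -> I [::] s ->
  (forall done x rest s', xs = done ++ x :: rest -> I done s' ->
     within t (body x s') (I (rcons done x))) ->
  within (t.+1 * n).+1 (for_each xs body s) (I xs).
Proof.
move=> xsn I0 Ibody; apply: within_impl (within_for_each I0 Ibody) => //.
by rewrite ltnS leq_mul2l xsn orbT.
Qed.

(** * Lists of labels and the two tables *)

Definition labels : seq int := [:: -2; -1; 0; 1; 2]%Z.

Definition label_list (L : seq int) : bool := uniq L && all (mem labels) L.

Lemma label_list_size L : label_list L -> size L <= 5.
Proof. by case/andP=> uL /allP sL; apply: (@uniq_leq_size _ L labels). Qed.

(** Insertions are specified relative to the list they start from, so that this
    specification is closed under loops and hence nests. *)
Definition collects t (m : timed (seq int)) (L F : seq int) : Prop :=
  within t m (fun L' => label_list L' /\ L' =i L ++ F).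

Lemma collects_for_each (X : eqType) n t (F : X -> seq int)
    (body : X -> seq int -> timed (seq int)) xs L :
  size xs <= n ->
  {in xs, forall x L', label_list L' -> collects t (body x L') L' (F x)} ->
  label_list L ->
  collects (t.+1 * n).+1 (for_each xs body L) L (flatten (map F xs)).
Proof.
move=> xsn bodyF LL; apply: (@within_for_each_le _ _ n t (fun done L' =>
    label_list L' /\ L' =i L ++ flatten (map F done))) => //.
  by split=> // a; rewrite cats0.
move=> done x rest L' Exs [LL' EL'].
have: x \in xs by rewrite Exs mem_cat mem_head orbT.
move=> /bodyF /(_ _ LL'); apply: within_impl => // L'' [LL'' EL'']; split=> // a.
by rewrite EL'' map_rcons flatten_rcons catA !mem_cat EL' mem_cat.
Qed.

Lemma add_label_collects c L :
  c \in labels -> label_list L -> collects 12 (add_label c L) L [:: c].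
Proof.
move=> cl LL.
have lookup : within 11 (for_each L (fun b found => step (found || (b == c))) false)
    (fun found => found = (c \in L)).
  apply: (@within_for_each_le _ _ 5 1 (fun done found => found = (c \in done))) => //.
    exact: label_list_size.
  move=> done b rest found _ ->; apply: within_step.
  by rewrite mem_rcons inE orbC eq_sym.
apply: within_bind lookup _ => _ ->; apply: within_step; case: ifPn => cL; split=> //.
- by move=> a; rewrite mem_cat inE; case: eqP => [->|]; rewrite ?cL ?orbF.
- have /andP[uL /allP Ll] := LL; rewrite /label_list cons_uniq cL uL.
  by apply/allP=> a; rewrite in_cons => /predU1P[->|/Ll].
- by move=> a; rewrite mem_cat !inE orbC.
Qed.

(** The labels that the two-graph rule is to produce, as a plain list. *)
Definition joined (A B : seq int) : seq int :=
  flatten [seq flatten [seq two_graph_labels a b | b <- B] | a <- A].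

Lemma joinedP A B c :
  reflect (exists a b, [/\ a \in A, b \in B & c \in two_graph_labels a b])
    (c \in joined A B).
Proof.
apply: (iffP flatten_mapP) => [[a aA /flatten_mapP[b bB cab]]|[a [b [aA bB cab]]]].
  by exists a, b.
by exists a => //; apply/flatten_mapP; exists b.
Qed.

Lemma add_labels_collects cs L :
  size cs <= 5 -> all (mem labels) cs -> label_list L ->
  collects 66 (for_each cs add_label L) L cs.
Proof.
move=> cs5 /allP csl LL; rewrite -[in X in collects _ _ _ X](flatten_seq1 cs).
apply: (@collects_for_each _ 5 12) => // c /csl cl L' LL'.
exact: add_label_collects.
Qed.

(** Both label lists have at most five entries, so each of the nested loops makes
    at most five rounds: 341 = 5 * (67 + 1) + 1 and 1711 = 5 * (341 + 1) + 1. *)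
Lemma two_graph_rule_spec A B : label_list A -> label_list B ->
  within 1711 (two_graph_rule A B) (fun L => label_list L /\ L =i joined A B).
Proof.
move=> LA LB; have := label_list_size LA; have := label_list_size LB => B5 A5.
apply: (@collects_for_each _ 5 341) => // a _ L LL.
apply: (@collects_for_each _ 5 67) => // b _ L' LL'.
apply: within_bind (within_step (P := fun cs => cs = two_graph_labels a b) _) _ => //.
move=> _ ->; apply: add_labels_collects => //.
  by rewrite size_map size_filter; apply: count_size.
by apply/allP=> c /mapP[r]; rewrite mem_filter => /andP[_]; rewrite !inE
  => /or4P[|||/orP[]] /eqP -> ->.
Qed.

Lemma eq_mem_all (T : eqType) (s1 s2 : seq T) :
  all (mem s2) s1 && all (mem s1) s2 -> s1 =i s2.
Proof. by case/andP=> /allP s12 /allP s21 x; apply/idP/idP=> [/s12|/s21]. Qed.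

(** A lone vertex has the labels 0 (when it is in the set) and -1 (when it is
    not, the condition on its neighbours being void). The one-vertex rule is
    thus a case of the two-graph rule, which spares it a proof of its own. *)
Lemma one_vertex_labelsE a :
  a \in labels -> one_vertex_labels a =i joined [:: a] [:: -1; 0]%Z.
Proof.
by rewrite !inE => /or4P[|||/orP[]] /eqP ->; apply: eq_mem_all; vm_compute.
Qed.

Lemma one_vertex_rule_spec A : label_list A ->
  within 341 (one_vertex_rule A)
    (fun L => label_list L /\ L =i joined A [:: -1; 0]%Z).
Proof.
move=> LA; have A5 := label_list_size LA.
have [_ /allP Al] := andP LA.
have: collects 341 (one_vertex_rule A) [::] (flatten (map one_vertex_labels A)).
  apply: (@collects_for_each _ 5 67) => // a aA L LL.
  apply: within_bind (within_step (P := fun cs => cs = one_vertex_labels a) _) _ => //.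
  move=> _ ->; move: {aA Al}(Al _ aA); rewrite !inE.
  by move=> al; apply: add_labels_collects => //; move: al => /or4P[|||/orP[]] /eqP ->.
apply: within_impl => // L [LL EL]; split=> // c; rewrite EL.
apply/flatten_mapP/joinedP=> [[a aA]|[a [b [aA bB cab]]]].
  rewrite (one_vertex_labelsE (Al _ aA)) => /joinedP[a' [b [+ bB cab]]].
  by rewrite mem_seq1 => /eqP Ea; exists a, b; rewrite -Ea in aA *.
exists a => //; rewrite (one_vertex_labelsE (Al _ aA)); apply/joinedP.
by exists a, b; rewrite mem_head.
Qed.

(** * Labels of a vertex and of two graphs joined by an edge *)

Section Labels.
Variables (V : finType) (e : rel V).

Definition deg_in (S : {set V}) (x : V) : nat := #|neighbors e x :&: S|.

(** The type I sets for v in the subgraph induced by A. Degrees are counted in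
    the whole graph, which is the same since S is contained in A. *)
Definition type_I (A : {set V}) (v : V) (S : {set V}) : Prop :=
  [/\ S \subset A,
      {in S &, forall x y, ~~ e x y},
      v \notin S -> deg_in S v <= 2 &
      {in A, forall x, x != v -> x \notin S -> 1 <= deg_in S x <= 2}].

(** The label depends on A only through the neighbours of v that tell -1 from
    -2. *)
Definition label (A : {set V}) (v : V) (S : {set V}) : int :=
  if v \in S then 0%Z
  else if deg_in S v is 0 then
    if [forall x in neighbors e v :&: A, deg_in S x == 1] then (-1)%Z else (-2)%Z
  else Posz (deg_in S v).

Definition has_label (A : {set V}) (v : V) (a : int) : Prop :=
  exists2 S, type_I A v S & label A v S = a.

Definition lists_labels (A : {set V}) (v : V) (L : seq int) : Prop :=
  forall a, a \in L <-> has_label A v a.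

Lemma lists_labels_eq A v L L' : L =i L' -> lists_labels A v L -> lists_labels A v L'.
Proof. by move=> EL Lx a; rewrite -EL. Qed.

Variant label_spec (A : {set V}) (v : V) (S : {set V}) : int -> Prop :=
| LabelIn of v \in S : label_spec A v S 0%Z
| LabelOne of v \notin S & deg_in S v = 1 : label_spec A v S 1%Z
| LabelTwo of v \notin S & deg_in S v = 2 : label_spec A v S 2%Z
| LabelFree of v \notin S & deg_in S v = 0
    & [forall x in neighbors e v :&: A, deg_in S x == 1] : label_spec A v S (-1)%Z
| LabelFull of v \notin S & deg_in S v = 0
    & ~~ [forall x in neighbors e v :&: A, deg_in S x == 1] : label_spec A v S (-2)%Z.

Lemma labelP A v S : type_I A v S -> label_spec A v S (label A v S).
Proof.
case=> _ _ + _; rewrite /label; case: ifPn => [vS _|vS /(_ isT)]; first exact: LabelIn.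
case Ed: (deg_in S v) => [|[|[|k]]] // _; last 2 first.
- exact: LabelOne.
- exact: LabelTwo.
by case: ifPn => H; [apply: LabelFree | apply: LabelFull].
Qed.

Lemma has_label_labels A v a : has_label A v a -> a \in labels.
Proof. by case=> S /labelP[] *; subst a. Qed.

Lemma lists_labels_sub A v L : lists_labels A v L -> {subset L <= labels}.
Proof. by move=> Lx a /Lx; apply: has_label_labels. Qed.

Lemma deg_in0 x : deg_in set0 x = 0.
Proof. by rewrite /deg_in setI0 cards0. Qed.

Hypotheses (e_sym : symmetric e) (e_irr : irreflexive e).

Lemma lists_labels_set1 v : lists_labels [set v] v [:: -1; 0]%Z.
Proof.
have notv x : x \in [set v] -> x != v -> False by rewrite inE => /eqP-> /eqP.
move=> a; split; last first.
  case=> S SI <-; have [/subsetP S1 _ _ _] := SI.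
  have d0 : deg_in S v = 0.
    apply/eqP; rewrite cards_eq0; apply/eqP/setP=> x; rewrite !inE.
    apply/negP=> /andP[evx /S1]; rewrite inE => /eqP xv.
    by rewrite xv e_irr in evx.
  case: (labelP SI) => //.
  - by rewrite d0.
  - by rewrite d0.
  - move=> _ _ /negP[]; apply/forall_inP=> x; rewrite !inE => /andP[evx /eqP xv].
    by rewrite xv e_irr in evx.
rewrite !inE => /orP[]/eqP->.
  exists set0; first split=> //.
  - by rewrite sub0set.
  - by move=> x y; rewrite inE.
  - by move=> _; rewrite deg_in0.
  - by move=> x /notv/[apply].
  rewrite /label inE deg_in0; case: ifPn => // /negP[]; apply/forall_inP=> x.
  by rewrite !inE => /andP[evx /eqP xv]; rewrite xv e_irr in evx.
exists [set v]; last by rewrite /label set11.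
split=> //.
- by move=> x y; rewrite !inE => /eqP-> /eqP->; rewrite e_irr.
- by rewrite set11.
- by move=> x /notv/[apply].
Qed.

(** The label -1 says exactly that v can be added to S: its neighbours have one
    neighbour in S and so tolerate a second one. *)
Lemma has_label_free A v : has_label A v (-1)%Z -> v \in A -> has_label A v 0%Z.
Proof.
case=> S SI Sl vA; have := labelP SI; rewrite Sl; set a := (-1)%Z => spec.
have [vS dv0 /forall_inP free] : [/\ v \notin S, deg_in S v = 0 &
    [forall x in neighbors e v :&: A, deg_in S x == 1]].
  by move: (erefl a); rewrite {2}/a; case: spec.
have vS0 x : x \in S -> e v x = false.
  move=> xS; apply/negP=> evx; have : x \in neighbors e v :&: S by rewrite !inE evx.
  by rewrite (cards0_eq dv0) inE.
case: SI => SA Sind _ Sdom; exists (v |: S); last by rewrite /label setU11.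
split.
- by rewrite subUset sub1set vA.
- move=> x y /setU1P[->|xS] /setU1P[->|yS]; rewrite ?e_irr ?vS0 //.
    by rewrite e_sym vS0.
  exact: Sind.
- by rewrite setU11.
move=> x xA xv; rewrite in_setU1 negb_or => /andP[_ xS].
have -> : deg_in (v |: S) x = e x v + deg_in S x.
  rewrite /deg_in setIUr; have [exv|nexv] := boolP (e x v).
    have -> : neighbors e x :&: [set v] = [set v].
      by apply/setIidPr; rewrite sub1set inE.
    by rewrite cardsU1 !inE (negbTE vS) andbF.
  have -> : neighbors e x :&: [set v] = set0.
    by apply/setP=> y; rewrite !inE; case: eqP => [->|]; rewrite ?(negbTE nexv) ?andbF.
  by rewrite set0U.
have := Sdom x xA xv xS; have [exv|_] := boolP (e x v); last by [].
by have /eqP -> // : deg_in S x == 1; apply: free; rewrite !inE e_sym exv.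
Qed.

(** Only the endpoint u of the joining edge can gain a neighbour from the other
    side, and then only v. *)
Lemma deg_in_join (A B SA SB : {set V}) u v x :
  [disjoint A & B] -> {in A & B, forall x y, e x y = (x == u) && (y == v)} ->
  v \in B -> SA \subset A -> SB \subset B -> x \in A ->
  deg_in (SA :|: SB) x = deg_in SA x + ((x == u) && (v \in SB)).
Proof.
move=> AB0 edgeAB vB /subsetP sA /subsetP sB xA.
have E : neighbors e x :&: SB = if (x == u) && (v \in SB) then [set v] else set0.
  apply/setP=> y; rewrite !inE; case: ifPn => [/andP[xu vS]|H]; rewrite !inE.
    apply/andP/eqP=> [[exy /sB yB]|->]; last by rewrite edgeAB ?xu ?eqxx.
    by move: exy; rewrite edgeAB // => /andP[_ /eqP].
  apply/negP=> /andP[exy yS]; move: exy; rewrite edgeAB //; last exact: sB.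
  by move=> /andP[xu /eqP yv]; rewrite xu -yv yS in H.
rewrite /deg_in setIUr cardsU E.
have -> : (neighbors e x :&: SA) :&:
    (if (x == u) && (v \in SB) then [set v] else set0) = set0.
  apply/setP=> y; rewrite -E !inE; apply/negP=> /andP[/andP[_ yA] /andP[_ yB]].
  by have := sB _ yB; rewrite (disjointFr AB0 (sA _ yA)).
by rewrite cards0 subn0; case: ifP; rewrite ?cards1 ?cards0.
Qed.

Section Join.
Variables (A B : {set V}) (u v : V).
Hypotheses (AB0 : [disjoint A & B]) (uA : u \in A) (vB : v \in B).
Hypothesis edgeAB : {in A & B, forall x y, e x y = (x == u) && (y == v)}.

(** Whether two type I sets with labels a of u and b of v form a type I set for
    v after joining the edge uv. At most one endpoint is chosen; a chosen
    endpoint gives the other one an extra neighbour, which must be at most its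
    second; if neither is chosen, then u must be dominated within its own side,
    whereas v may still wait for a later edge. *)
Definition compatible (a b : int) : bool :=
  if b == 0%Z then a \in [:: -2; -1; 1]%Z
  else if a == 0%Z then b \in [:: -2; -1; 1]%Z
  else a \in [:: 1; 2]%Z.

Definition joined_label (a b : int) : int :=
  if b == 0%Z then 0%Z
  else if a == 0%Z then if b == 1%Z then 2%Z else 1%Z
  else if b == (-1)%Z then if a == 1%Z then (-1)%Z else (-2)%Z
  else b.

Section Glue.
Variables SA SB : {set V}.
Hypotheses (sA : SA \subset A) (sB : SB \subset B).

Let degA x : x \in A ->
  deg_in (SA :|: SB) x = deg_in SA x + ((x == u) && (v \in SB)).
Proof. by move=> xA; apply: (deg_in_join AB0 edgeAB vB). Qed.

Let degB x : x \in B ->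
  deg_in (SA :|: SB) x = deg_in SB x + ((x == v) && (u \in SA)).
Proof.
move=> xB; rewrite setUC; apply: (@deg_in_join B A) => //.
  by rewrite disjoint_sym.
by move=> y z yB zA; rewrite e_sym edgeAB // andbC.
Qed.

Let inA x : x \in A -> (x \in SA :|: SB) = (x \in SA).
Proof.
move=> xA; rewrite inE; case: (boolP (x \in SB)) => [/(subsetP sB) xB|]; last by rewrite orbF.
by have := disjointFr AB0 xA; rewrite xB.
Qed.

Let inB x : x \in B -> (x \in SA :|: SB) = (x \in SB).
Proof.
move=> xB; rewrite inE; case: (boolP (x \in SA)) => [/(subsetP sA) xA|] //.
by have := disjointFr AB0 xA; rewrite xB.
Qed.

(** Each vertex other than u and v sees the same part of S on its own side as in
    the joined graph, so only the conditions at u and at v change. *)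
Lemma type_I_join :
  type_I (A :|: B) v (SA :|: SB) <->
  [/\ type_I A u SA, type_I B v SB, ~~ ((u \in SA) && (v \in SB)),
      v \notin SB -> deg_in SB v + (u \in SA) <= 2 &
      u \notin SA -> 1 <= deg_in SA u + (v \in SB) <= 2].
Proof.
have uv : u != v by apply: contraTneq uA => ->; rewrite (disjointFl AB0 vB).
split=> [[_ ind vdeg dom]|[[_ indA udeg domA] [_ indB vdeg domB] uv0 v2 u12]].
- have u12 : u \notin SA -> 1 <= deg_in SA u + (v \in SB) <= 2.
    move=> uS; have := dom u; rewrite inE uA inA //= degA // eqxx.
    by apply.
  have v2 : v \notin SB -> deg_in SB v + (u \in SA) <= 2.
    by move=> vS; move: vdeg; rewrite inB // degB // eqxx; apply.
  split=> //.
  + split=> //.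
    * by move=> x y xS yS; apply: ind; rewrite inE ?xS ?yS.
    * by move=> /u12; lia.
    move=> x xA xu xS; have := dom x; rewrite inE xA inA // degA // (negbTE xu) addn0.
    by apply=> //; apply: contraTneq xA => ->; rewrite (disjointFl AB0 vB).
  + split=> //.
    * by move=> x y xS yS; apply: ind; rewrite inE ?xS ?yS orbT.
    * by move=> /v2; lia.
    move=> x xB xv xS; have := dom x; rewrite inE xB orbT inB // degB // (negbTE xv) addn0.
    by apply.
  + apply/andP=> -[uS vS]; have := ind u v; rewrite !inE uS vS orbT => /(_ isT isT).
    by rewrite edgeAB // !eqxx.
split.
- exact: setUSS.
- have noAB x y : x \in SA -> y \in SB -> ~~ e x y.
    move=> xS yS; rewrite edgeAB ?(subsetP sA x) ?(subsetP sB y) //.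
    by apply: contra uv0 => /andP[/eqP<- /eqP<-]; rewrite xS.
  move=> x y /setUP[xS|xS] /setUP[yS|yS].
  + exact: indA.
  + exact: noAB.
  + by rewrite e_sym noAB.
  + exact: indB.
- by rewrite inB // degB // eqxx.
move=> x /setUP[xA|xB] xv.
  rewrite inA // degA //; case: (eqVneq x u) => [->|xu] xS; first exact: u12.
  by rewrite addn0 domA.
by rewrite inB // degB // (negbTE xv) addn0; apply: domB.
Qed.

Lemma compatibleP : type_I A u SA -> type_I B v SB ->
  compatible (label A u SA) (label B v SB) =
  [&& ~~ ((u \in SA) && (v \in SB)),
      (v \notin SB) ==> (deg_in SB v + (u \in SA) <= 2) &
      (u \notin SA) ==> (1 <= deg_in SA u + (v \in SB) <= 2)].
Proof.
move=> /labelP Hu /labelP Hv.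
by case: Hu => [->|/negbTE-> ->|/negbTE-> ->|/negbTE-> -> _|/negbTE-> -> _];
  case: Hv => [->|/negbTE-> ->|/negbTE-> ->|/negbTE-> -> _|/negbTE-> -> _].
Qed.

Lemma label_join : type_I A u SA -> type_I B v SB ->
  compatible (label A u SA) (label B v SB) ->
  label (A :|: B) v (SA :|: SB) = joined_label (label A u SA) (label B v SB).
Proof.
move=> tA tB; have uv : u != v.
  by apply: contraTneq uA => ->; rewrite (disjointFl AB0 vB).
have free : v \notin SB -> u \notin SA ->
    [forall x in neighbors e v :&: (A :|: B), deg_in (SA :|: SB) x == 1] =
    (deg_in SA u == 1) && [forall x in neighbors e v :&: B, deg_in SB x == 1].
  move=> /negbTE vS /negbTE uS.
  apply/forall_inP/andP=> [H|[du /forall_inP H] x].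
    split.
      have := H u; rewrite degA // vS andbF addn0; apply.
      by rewrite !inE uA e_sym edgeAB ?eqxx.
    apply/forall_inP=> x; rewrite !inE => /andP[evx xB].
    by have := H x; rewrite degB // uS andbF addn0; apply; rewrite !inE evx xB orbT.
  rewrite !inE => /andP[evx /orP[xA|xB]].
    by move: evx; rewrite e_sym edgeAB // => /andP[/eqP-> _]; rewrite degA // vS andbF addn0.
  by rewrite degB // uS andbF addn0 H // !inE evx.
rewrite [LHS]/label inB // degB // eqxx andTb.
have /labelP Hu := tA; have /labelP Hv := tB; move: free.
by case: Hu => [->|/[dup]/negbTE-> -> ->|/[dup]/negbTE-> -> ->
               |/[dup]/negbTE-> -> -> _|/[dup]/negbTE-> -> -> _] free;
  case: Hv free => [->|/[dup]/negbTE-> -> ->|/[dup]/negbTE-> -> ->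
                   |/[dup]/negbTE-> -> -> H|/[dup]/negbTE-> -> -> H];
  rewrite ?addn0 //= => H'; rewrite ?H' ?H ?(negbTE H).
Qed.

End Glue.

(** The two-graph table has entries beyond those of a plain union of two type I
    sets: they first add u or v to a set of label -1. They create no new label,
    since the label 0 is then on the list as well (has_label_free). *)
Definition promotions (a : int) : seq int :=
  if a == (-1)%Z then [:: -1; 0]%Z else [:: a].

Lemma two_graph_labels_complete a b : a \in labels -> b \in labels ->
  compatible a b -> joined_label a b \in two_graph_labels a b.
Proof.
have /allP table : all (fun a => all (fun b =>
    compatible a b ==> (joined_label a b \in two_graph_labels a b)) labels) labels.
  by vm_compute.
by move=> /table/allP/[apply]/implyP.
Qed.

Lemma two_graph_labels_sound a b c : a \in labels -> b \in labels ->
  c \in two_graph_labels a b ->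
  exists a' b', [/\ a' \in promotions a, b' \in promotions b,
                    compatible a' b' & c = joined_label a' b'].
Proof.
have /allP table : all (fun a => all (fun b => all (fun c =>
    has (fun a' => has (fun b' => compatible a' b' && (c == joined_label a' b'))
      (promotions b)) (promotions a)) (two_graph_labels a b)) labels) labels.
  by vm_compute.
move=> /table/allP/[apply]/allP/[apply]/hasP[a' a'P /hasP[b' b'P /andP[ab' /eqP cE]]].
by exists a', b'.
Qed.

(** The central fact: the two-graph rule turns complete lists of labels into a
    complete list of labels. Every type I set of the joined graph splits into
    its two sides, and compatible sides glue. *)
Lemma lists_labels_join LA LB :
  lists_labels A u LA -> lists_labels B v LB -> lists_labels (A :|: B) v (joined LA LB).
Proof.
move=> xA xB c; split.
  move=> /joinedP[a [b [aL bL cab]]].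
  have al := lists_labels_sub xA aL; have bl := lists_labels_sub xB bL.
  have [a' [b' [a'P b'P ab' ->]]] := two_graph_labels_sound al bl cab.
  have /xA hA : a' \in LA.
    move: a'P; rewrite /promotions; case: eqP => [Ea|_]; rewrite !inE; last by move/eqP->.
    rewrite Ea in aL; case/orP=> /eqP-> //; apply/xA; apply: has_label_free => //.
    exact/xA.
  have /xB hB : b' \in LB.
    move: b'P; rewrite /promotions; case: eqP => [Ea|_]; rewrite !inE; last by move/eqP->.
    rewrite Ea in bL; case/orP=> /eqP-> //; apply/xB; apply: has_label_free => //.
    exact/xB.
  case: hA hB ab' => SA tA <- [SB tB <-] ab'.
  have [[sA _ _ _] [sB _ _ _]] := (tA, tB).
  exists (SA :|: SB); last exact: label_join.
  move: ab'; rewrite compatibleP // => /and3P[uv0 /implyP v2 /implyP u12].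
  exact/type_I_join.
case=> S tS <-; have [sS _ _ _] := tS.
have ES : S = (S :&: A) :|: (S :&: B) by rewrite -setIUr; apply/esym/setIidPl.
have [sA sB] := (subsetIr S A, subsetIr S B).
move: tS; rewrite ES => /(type_I_join sA sB)[tA tB uv0 v2 u12].
have ab : compatible (label A u (S :&: A)) (label B v (S :&: B)).
  by rewrite compatibleP //; apply/and3P; split=> //; apply/implyP.
rewrite label_join //; apply/joinedP; exists (label A u (S :&: A)), (label B v (S :&: B)).
have hA : has_label A u (label A u (S :&: A)) by exists (S :&: A).
have hB : has_label B v (label B v (S :&: B)) by exists (S :&: B).
split; [exact/xA|exact/xB|apply: two_graph_labels_complete => //].
  exact: has_label_labels hA.
exact: has_label_labels hB.
Qed.
End Join.
End Labels.

(** * Branches of a tree *)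

Lemma connect_ind (V : finType) (r : rel V) (P : V -> Prop) x :
  P x -> (forall y z, connect r x y -> P y -> r y z -> P z) ->
  forall y, connect r x y -> P y.
Proof.
move=> Px IH y /connectP[p + ->]; elim/last_ind: p => [//|p z IHp].
rewrite rcons_path last_rcons => /andP[pp rz]; apply: IH rz; last exact: IHp.
by apply/connectP; exists p.
Qed.

(** For a neighbour p of v, cut v (Some p) removes the edge vp and branch v
    (Some p) is the component of v that is left: the subtree of v when p is its
    parent. With None nothing is removed, which is the case of the root. *)
Definition cut (V : finType) (e : rel V) (v : V) (po : option V) : rel V :=
  [rel x y | [&& e x y, ~~ ((x == v) && (po == Some y))
                      & ~~ ((y == v) && (po == Some x))]].

Definition branch (V : finType) (e : rel V) (v : V) (po : option V) : {set V} :=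
  [set w | connect (cut e v po) v w].

(** Being the parent is defined statically, by removing an edge separating v from
    the root r, and not by the run of the algorithm; the root itself has parent
    None. *)
Definition rooted (V : finType) (e : rel V) (r v : V) (po : option V) : bool :=
  if po is Some p then e v p && (r \notin branch e v po) else v == r.

Section Tree.
Variables (V : finType) (e : rel V).
Hypothesis treeE : tree e.

Let e_sym : symmetric e. Proof. by case: treeE. Qed.
Let e_irr : irreflexive e. Proof. by case: treeE. Qed.
Let e_conn x y : connect e x y. Proof. by case: treeE. Qed.

(** Connectedness, used as an induction principle: most facts on branches below
    follow by showing that some set of vertices has no edge leaving it. *)
Lemma closed_full (A : {set V}) x :
  x \in A -> (forall y z, y \in A -> e y z -> z \in A) -> A = setT.
Proof.
move=> xA Acl; apply/setP=> y; rewrite inE.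
by apply: (@connect_ind _ e (fun y => y \in A) x) (e_conn x y) => // z t _; apply: Acl.
Qed.

Lemma branch_self v po : v \in branch e v po.
Proof. by rewrite inE connect0. Qed.

Lemma branch_root v : branch e v None = setT.
Proof.
apply/setP=> x; rewrite !inE; have := e_conn v x.
by rewrite (@eq_connect _ _ e) // => y z; rewrite /cut /= !andbF andbT.
Qed.

(** In a tree every edge is a bridge: a path from v to p avoiding the edge vp
    would close up to a cycle. This is the only use of acyclicity. *)
Lemma branch_parent v p : e v p -> p \notin branch e v (Some p).
Proof.
move=> evp; rewrite inE; apply/connectP=> -[q pq].
case/shortenP: pq => q' pq' uq' _ Ep.
have cq' : cycle e (v :: q').
  rewrite /= rcons_path -Ep e_sym evp andbT.
  by apply: sub_path pq' => x y /and3P[].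
have [_ _ _ _ acy] := treeE; apply: (acy (v :: q')); last by rewrite /ucycle cq'.
(* A shorter path would be empty or the removed edge itself. *)
case: q' Ep pq' {uq' cq'} => [|y [|]] //= Ep.
  by rewrite Ep e_irr in evp.
by rewrite /cut /= -Ep !eqxx andbF.
Qed.

Lemma branch_exit v po x y :
  x \in branch e v po -> e x y -> y \notin branch e v po -> x = v /\ po = Some y.
Proof.
move=> xB exy yB; have [/andP[/eqP-> /eqP->]//|nout] := boolP ((x == v) && (po == Some y)).
have [/andP[/eqP Ey _]|nin] := boolP ((y == v) && (po == Some x)).
  by rewrite Ey branch_self in yB.
case/negP: yB; move: xB; rewrite !inE => /connect_trans; apply.
by apply: connect1; rewrite /cut /= exy nout.
Qed.

(** An edge leaving the intersection of the two branches would leave both at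
    once, hence start at u and at w. So the intersection, if inhabited, is
    everything and contains v, against branch_parent. *)
Lemma branch_disjoint v u w : e v u -> e v w -> u != w ->
  [disjoint branch e u (Some v) & branch e w (Some v)].
Proof.
move=> evu evw uw; rewrite -setI_eq0; apply/set0Pn=> -[x xI].
have evu' : e u v by rewrite e_sym. have evw' : e w v by rewrite e_sym.
have : v \in branch e u (Some v) :&: branch e w (Some v).
  rewrite (closed_full xI) // => y z /setIP[yu yw] eyz.
  have zu : z \in branch e u (Some v).
    apply/negPn/negP=> /(branch_exit yu eyz)[Ey [Ez]]; subst y z.
    have [|Eu _] := branch_exit yw eyz; first exact: branch_parent.
    by rewrite Eu eqxx in uw.
  apply/setIP; split=> //.
  apply/negPn/negP=> /(branch_exit yw eyz)[Ey [Ez]]; subst y z.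
  by rewrite (negbTE (branch_parent evu')) in zu.
by rewrite inE (negbTE (branch_parent evu')).
Qed.

Lemma branch_disjoint_edge v p : e v p ->
  [disjoint branch e v (Some p) & branch e p (Some v)].
Proof.
move=> evp; rewrite -setI_eq0; apply/set0Pn=> -[x xI].
have epv : e p v by rewrite e_sym.
have : v \in branch e v (Some p) :&: branch e p (Some v).
  rewrite (closed_full xI) // => y z /setIP[yv yp] eyz.
  apply/setIP; split; apply/negPn/negP.
    move=> /(branch_exit yv eyz)[Ey [Ez]]; subst y z.
    by rewrite (negbTE (branch_parent epv)) in yp.
  move=> /(branch_exit yp eyz)[Ey [Ez]]; subst y z.
  by rewrite (negbTE (branch_parent evp)) in yv.
by rewrite inE (negbTE (branch_parent epv)) andbF.
Qed.

Lemma branch_cover v p : e v p ->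
  branch e v (Some p) :|: branch e p (Some v) = setT.
Proof.
move=> evp; apply: (@closed_full _ v); first by rewrite inE branch_self.
move=> y z yU eyz; apply/negPn/negP; rewrite inE negb_or => /andP[zv zp].
case/setUP: yU => yB.
  by have [_ [Ez]] := branch_exit yB eyz zv; rewrite -Ez branch_self in zp.
by have [_ [Ez]] := branch_exit yB eyz zp; rewrite -Ez branch_self in zv.
Qed.

(** The recursive structure that the dynamic programming follows. *)
Lemma branchE v po : (if po is Some p then e v p else true) ->
  branch e v po =
  v |: \bigcup_(u in neighbors e v | Some u != po) branch e u (Some v).
Proof.
move=> evp; apply/eqP; rewrite eqEsubset; apply/andP; split; apply/subsetP=> x.
  rewrite {1}inE; apply: (@connect_ind _ _ (fun x => x \in _)) => [|y z _].
    by rewrite setU11.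
  move=> yR /and3P[eyz nout nin].
  case/setU1P: yR => [Ey|/bigcupP[u /andP[uN upo] yu]].
    subst y; apply/setU1P; right; apply/bigcupP; exists z; last exact: branch_self.
    by rewrite !inE eyz eq_sym; move: nout; rewrite eqxx.
  have [zu|zu] := boolP (z \in branch e u (Some v)).
    by apply/setU1P; right; apply/bigcupP; exists u => //; apply/andP.
  by have [_ [->]] := branch_exit yu eyz zu; rewrite setU11.
case/setU1P=> [->|/bigcupP[u /andP[]]]; first exact: branch_self.
rewrite inE => evu upo; rewrite inE.
have euv : e u v by rewrite e_sym.
apply: (@connect_ind _ _ (fun x => x \in _)) => [|y z yu yB /and3P[eyz nout nin]].
  rewrite inE; apply: connect1; rewrite /cut /= evu eqxx eq_sym upo /=.
  by apply: contraTN evu => /andP[/eqP-> _]; rewrite e_irr.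
apply/negPn/negP=> /(branch_exit yB eyz)[Ey _]; subst y.
by have := branch_parent euv; rewrite inE yu.
Qed.

(** No vertex of a branch but its root has a neighbour outside, so restricting S
    to the branch alters the domination of its root only. In particular each
    branch has a label if the tree has an independent [1,2]-set. *)
Lemma independent_type_I (S : {set V}) v po : independent_12_set e S ->
  type_I e (branch e v po) v (S :&: branch e v po).
Proof.
move=> [Sind Sdom]; split; first exact: subsetIr.
- by move=> x y /setIP[xS _] /setIP[yS _]; apply: Sind.
- rewrite inE branch_self andbT => /Sdom/andP[_]; apply: leq_trans.
  by rewrite subset_leq_card // setIS // subsetIl.
move=> x xB xv; rewrite inE xB andbT => /Sdom; rewrite /deg_in.
suff -> : neighbors e x :&: (S :&: branch e v po) = neighbors e x :&: S by [].
apply/setP=> y; rewrite setIA [LHS]in_setI andb_idr // !in_setI inE => /andP[exy _].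
apply/negPn/negP=> yB.
by have [Ex] := branch_exit xB exy yB; rewrite Ex eqxx in xv.
Qed.

(** A type I set for r in the whole tree misses being an independent [1,2]-set
    only if r has no neighbour in it, that is, has label -1 or -2. *)
Lemma independent_label r :
  (exists S : {set V}, independent_12_set e S) <->
  exists2 a, a \in [:: 0; 1; 2]%Z & has_label e (branch e r None) r a.
Proof.
split=> [[S iS]|[a a012 [S tS]]].
  have tS := independent_type_I r None iS; rewrite branch_root setIT in tS *.
  exists (label e setT r S); last by exists S.
  case: (labelP tS) => // rS dr0 _; have [_ /(_ _ rS)] := iS.
    by rewrite -/(deg_in e S r) dr0.
  by rewrite -/(deg_in e S r) dr0.
move=> Sa; exists S; have [_ Sind Sr Sdom] := tS; split=> // x xS.
have [xr|xr] := eqVneq x r; last by apply: Sdom => //; rewrite branch_root.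
rewrite {x}xr in xS *; move: Sa a012 => <-.
by case: (labelP tS) xS => [->//|_ d _|_ d _|//|//] _; rewrite -/(deg_in e S r) d.
Qed.

(** * Parents in a rooted tree *)

Section Rooted.
Variable r : V.

(** The branch of u away from v lies inside that of v away from its parent. *)
Lemma rooted_child v po u :
  rooted e r v po -> e v u -> Some u != po -> rooted e r u (Some v).
Proof.
move=> rv evu upo; rewrite /= e_sym evu /=.
case: po rv upo => [p /andP[evp]|/eqP<- _]; last by rewrite branch_parent // e_sym.
rewrite branchE // => rB upo; apply: contra rB => rB.
by apply/setU1P; right; apply/bigcupP; exists u => //; rewrite inE evu.
Qed.

(** The two branches at an edge cover the tree, so one of them contains r. *)
Lemma rooted_antisym v u : rooted e r u (Some v) -> ~~ rooted e r v (Some u).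
Proof.
move=> /andP[euv ru]; apply/andP=> -[evu rv].
have : r \in [set: V] by [].
by rewrite -(branch_cover evu) inE (negbTE ru) (negbTE rv).
Qed.

Lemma rooted_uniq v po po' : rooted e r v po -> rooted e r v po' -> po = po'.
Proof.
case: po po' => [p|] [q|] //; last 2 first.
- by move=> /andP[_] + /eqP vr; rewrite -{1}vr branch_self.
- by move=> /eqP <- /andP[_]; rewrite branch_self.
move=> rp rq; apply/eqP; apply: contraLR rp => pq.
have [evp|nevp] := boolP (e v p); last by rewrite /= (negbTE nevp).
by apply: rooted_antisym; apply: (rooted_child rq).
Qed.

Lemma rooted_parent v po u : rooted e r v po ->
  rooted e r u (Some v) = e v u && (po != Some u).
Proof.
move=> rv; apply/idP/andP=> [ru|[evu upo]]; last first.
  by apply: (rooted_child rv) => //; rewrite eq_sym.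
split; first by case/andP: ru; rewrite e_sym.
by apply: contraL rv => /eqP->; apply: rooted_antisym.
Qed.

(** If v is not r, then r lies in the branch of some neighbour u of v away from
    v, and that u is the parent. *)
Lemma rooted_exists v : exists po, rooted e r v po.
Proof.
have : r \in branch e v None by rewrite branch_root.
rewrite branchE // => /setU1P[->|/bigcupP[u /andP[+ _] ru]].
  by exists None; rewrite /= eqxx.
rewrite inE => evu; exists (Some u); rewrite /= evu.
by apply/negP=> rv; have := branch_disjoint_edge evu; move/disjointFr/(_ rv); rewrite ru.
Qed.

End Rooted.

(** Each vertex has at most one neighbour that is not its child, and each vertex
    is a child of at most one vertex. *)
Lemma sum_degrees : \sum_(v : V) #|neighbors e v| <= 2 * #|V|.
Proof.
case: (pickP V) => [r _|V0]; last by rewrite big_pred0.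
have deg v : #|neighbors e v| <= \sum_(u : V) (rooted e r u (Some v) : nat) + 1.
  have [po rv] := rooted_exists r v.
  rewrite (eq_bigr (fun u => (e v u && (po != Some u)) : nat)); last first.
    by move=> u _; rewrite (rooted_parent _ rv).
  rewrite -big_mkcond sum1_card /=.
  have sub : neighbors e v \subset
      [set u | e v u && (po != Some u)] :|: [set u | po == Some u].
    by apply/subsetP=> u; rewrite !inE => ->; rewrite orNb.
  apply: leq_trans (subset_leq_card sub) _; apply: leq_trans (leq_card_setU _ _) _.
  rewrite cardsE leq_add2l; case: po {rv sub} => [p|]; last first.
    by rewrite (_ : [set u | _] = set0) ?cards0 //; apply/setP=> u; rewrite !inE.
  by rewrite (_ : [set u | _] = [set p]) ?cards1 //; apply/setP=> u; rewrite !inE eq_sym.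
have := leq_sum (index_enum V) (P := xpredT) (fun v _ => deg v).
move/leq_trans; apply.
rewrite big_split /= sum1_card mul2n -addnn leq_add2r exchange_big -sum1_card.
apply: leq_sum => u _; rewrite -big_mkcond sum1_card.
rewrite leqNgt; apply/negP=> /card_gt1P[v [w [rv rw]]].
have [-> /eqP//] := rooted_uniq (rv : rooted e r u (Some v)) (rw : rooted e r u (Some w)).
Qed.

End Tree.

(** * The loops over one adjacency list *)

Section Primitives.
Variables (V : finType) (adj : V -> seq V).

Definition leaf (v : V) : bool := size (adj v) == 1.

Lemma is_leafE v : is_leaf adj v = step (leaf v).
Proof. by rewrite /is_leaf /leaf; case: (adj v) => [|x []]. Qed.

Lemma within_is_leaf v : within 1 (is_leaf adj v) (fun b => b = leaf v).
Proof. by rewrite is_leafE. Qed.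

Lemma is_support_spec v :
  within (3 * size (adj v)).+1 (is_support adj v) (fun b => b = has leaf (adj v)).
Proof.
apply: (@within_for_each _ _ 2 (fun done b => b = has leaf done)) => // done u _ b _ ->.
apply: (@within_bind _ _ 1 1) (within_is_leaf u) _ => _ ->; apply: within_step.
by rewrite has_rcons orbC.
Qed.

Lemma find_non_leaf_spec vs :
  within (2 * size vs).+1 (find_non_leaf adj vs)
    (fun o => if o is Some r then ~~ leaf r else all leaf vs).
Proof.
elim: vs => [|v vs IH] //=.
apply: (@within_impl _ (1 + (2 * size vs).+1)) => //; first by lia.
  by move=> o; apply.
apply: within_bind (within_is_leaf v) _ => _ ->; case: ifPn => // lv.
Qed.

Lemma new_array_spec (vs : seq V) A (a : A) :
  within (2 * size vs).+1 (new_array vs a) (fun f => forall v, f v = a).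
Proof.
apply: (@within_for_each _ _ 1 (fun _ f => forall v, f v = a)) => // done v _ f _ fa.
by apply: within_step => u; rewrite /write; case: ifP.
Qed.

Lemma children_spec (par : V -> option V) v :
  within (2 * size (adj v)).+1 (children adj par v)
    (fun us => us = rev [seq u <- adj v | par v != Some u]).
Proof.
apply: (@within_for_each _ _ 1 (fun done us =>
  us = rev [seq u <- done | par v != Some u])) => // done u _ us _ ->.
apply: within_step; rewrite filter_rcons; case: ifP => //= _.
by rewrite rev_rcons.
Qed.

Lemma split_leaves_spec us :
  within (3 * size us).+1 (split_leaves adj us)
    (fun ru => ru = (count leaf us, rev (filter (predC leaf) us))).
Proof.
apply: (@within_for_each _ _ 2 (fun done ru =>
  ru = (count leaf done, rev (filter (predC leaf) done)))) => // done u _ ru _ ->.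
apply: (@within_bind _ _ 1 1) (within_is_leaf u) _ => _ ->; apply: within_step.
rewrite filter_rcons -cats1 count_cat /= addn0; case: ifP => _ /=.
  by rewrite addn1.
by rewrite addn0 rev_rcons.
Qed.

End Primitives.

(** * Processing one vertex *)

Section Algorithm.
Variables (V : finType) (e : rel V) (adj : V -> seq V).
Hypotheses (treeE : tree e) (adjE : adjacency_lists e adj).

Let e_sym : symmetric e. Proof. by case: treeE. Qed.
Let e_irr : irreflexive e. Proof. by case: treeE. Qed.
Let adj_uniq v : uniq (adj v). Proof. by case: (adjE v). Qed.
Let mem_adj v u : (u \in adj v) = e v u. Proof. by case: (adjE v) => _ ->. Qed.

Lemma size_adj v : size (adj v) = #|neighbors e v|.
Proof.
by rewrite -(card_uniqP (adj_uniq v)); apply: eq_card => u; rewrite inE mem_adj.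
Qed.

(** The part of the branch of v that is taken into account once the children in
    s have been joined. *)
Definition partial_branch (v : V) (s : seq V) : {set V} :=
  v |: \bigcup_(u in s) branch e u (Some v).

Lemma eq_partial_branch v s s' : s =i s' -> partial_branch v s = partial_branch v s'.
Proof. by move=> Es; rewrite /partial_branch; congr (_ |: _); apply: eq_bigl. Qed.

Lemma partial_branch_nil v : partial_branch v [::] = [set v].
Proof. by rewrite /partial_branch big_pred0 ?setU0. Qed.

(** Joining one more child: its branch meets the part processed so far in the
    single edge uv. *)
Lemma lists_labels_cons v s u A L :
  u \notin s -> {in u :: s, forall w, e v w} ->
  lists_labels e (branch e u (Some v)) u A -> lists_labels e (partial_branch v s) v L ->
  lists_labels e (partial_branch v (u :: s)) v (joined A L).
Proof.
move=> us vs xA xL.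
have evu : e v u by apply: vs; rewrite mem_head.
have euv : e u v by rewrite e_sym.
have -> : partial_branch v (u :: s) = branch e u (Some v) :|: partial_branch v s.
  apply/setP=> x; rewrite !inE orbCA; congr (_ || _).
  apply/bigcupP/orP=> [[w /predU1P[->|ws] xw]|[xu|/bigcupP[w ws xw]]].
  - by left; move: xw; rewrite inE.
  - by right; apply/bigcupP; exists w.
  - by exists u; rewrite ?mem_head // inE.
  - by exists w => //; rewrite inE ws orbT.
have disj : [disjoint branch e u (Some v) & partial_branch v s].
  rewrite disjoint_sym disjoints_subset; apply/subsetP=> x /setU1P[->|/bigcupP[w ws xw]].
    by rewrite inE branch_parent.
  have uw : u != w by apply: contraNneq us => ->.
  have evw : e v w by apply: vs; rewrite inE ws orbT.
  by rewrite inE (disjointFl (branch_disjoint treeE evu evw uw)).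
apply: lists_labels_join => //; [exact: branch_self|by rewrite setU11|].
move=> x y xB yP; have yB := disjointFl disj yP.
apply/idP/andP=> [exy|[/eqP-> /eqP->]] //.
have [-> [->]] := branch_exit xB exy (negbT yB).
by rewrite !eqxx.
Qed.

Lemma branch_leaf u v : leaf adj u -> e u v -> branch e u (Some v) = [set u].
Proof.
move=> lu euv; rewrite branchE // big1 ?setU0 // => w /andP[].
rewrite inE -!mem_adj in euv *.
by move: lu; rewrite /leaf; case: (adj u) euv => [|x []] //;
  rewrite !inE => /eqP-> _ /eqP->; rewrite eqxx.
Qed.

(** Starting from the labels of a lone vertex, the star rule is the two-graph rule
    iterated over the leaves, each of which is a branch with the labels -1 and
    0 (star_labelsS). The value at 0 is what makes this an induction on the
    number of leaves. *)
Definition star_labels (r : nat) : seq int :=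
  if r is 0 then [:: -1; 0]%Z else (star_rule r).1.

Lemma star_labelsS r : joined [:: -1; 0]%Z (star_labels r) =i star_labels r.+1.
Proof. by apply: eq_mem_all; case: r => [|[|[|r]]]; vm_compute. Qed.

Lemma label_list_star r : label_list (star_labels r).
Proof. by case: r => [|[|[|r]]]. Qed.

Lemma lists_labels_star v s :
  uniq s -> all (leaf adj) s -> {in s, forall u, e v u} ->
  lists_labels e (partial_branch v s) v (star_labels (size s)).
Proof.
elim: s => [|u s IH] /=.
  by move=> _ _ _; rewrite partial_branch_nil; apply: lists_labels_set1.
move=> /andP[us uniq_s] /andP[lu ls] vs.
apply: lists_labels_eq (@star_labelsS _) _; apply: lists_labels_cons => //.
  rewrite branch_leaf //; first exact: lists_labels_set1.
  by rewrite e_sym; apply: vs; rewrite mem_head.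
by apply: IH => // w ws; apply: vs; rewrite inE ws orbT.
Qed.

Lemma join_children_spec R v us s L :
  uniq (us ++ s) -> {in us ++ s, forall u, e v u} ->
  {in us, forall u, label_list (R u) /\ lists_labels e (branch e u (Some v)) u (R u)} ->
  label_list L -> lists_labels e (partial_branch v s) v L ->
  within (1713 * size us).+1 (join_children R us L)
    (fun L' => label_list L' /\ lists_labels e (partial_branch v (us ++ s)) v L').
Proof.
move=> uniq_us vus Rus LL xL.
apply: (@within_for_each _ _ 1712 (fun done L' =>
  label_list L' /\ lists_labels e (partial_branch v (done ++ s)) v L')) => //.
move=> done u rest L' Eus [LL' xL'].
have [|LR xR] := Rus u; first by rewrite Eus mem_cat mem_head orbT.
apply: (@within_bind _ _ 1 1711) (within_step (P := fun A => A = R u) _) _ => // _ ->.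
apply: within_impl (two_graph_rule_spec LR LL') => // L'' [LL'' EL'']; split=> //.
apply: (@lists_labels_eq _ _ _ _ (joined (R u) L')); first by move=> a; rewrite EL''.
have -> : partial_branch v (rcons done u ++ s) = partial_branch v (u :: done ++ s).
  by apply: eq_partial_branch => w; rewrite mem_cat mem_rcons !inE mem_cat orbA.
apply: lists_labels_cons => //.
  move: uniq_us; rewrite Eus -catA cat_uniq mem_cat negb_or => /and3P[_ nd].
  rewrite /= mem_cat negb_or => /andP[/andP[_ ->] _]; rewrite andbT.
  by apply: contra nd => ud; apply/hasP; exists u; rewrite //= mem_head.
move=> w wP; apply: vus; move: wP.
rewrite Eus !inE !mem_cat !inE -!orbA => /or3P[->|->|->]; rewrite ?orbT //.
Qed.

Section Rooted.
Variable r : V.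
Hypotheses (V3 : 2 < #|V|) (r_inner : ~~ leaf adj r).

(** The support test runs over all neighbours of v, its parent included. As the
    parent is never a leaf, a positive answer yields a leaf among the children,
    without which the star rule would be wrong. *)
Lemma parent_inner v p : rooted e r v (Some p) -> ~~ leaf adj p.
Proof.
move=> rv; have [po rp] := rooted_exists treeE r p.
case: po rp => [q rp|/eqP->] //.
have evp : e p v by case/andP: (rv); rewrite e_sym.
have epq : e p q by case/andP: rp.
apply/negP=> lp; have vq : q = v.
  move: epq evp lp; rewrite -!mem_adj /leaf; case: (adj p) => [|x []] //.
  by rewrite !inE => /eqP-> /eqP->.
by have := rooted_antisym treeE rv; rewrite -vq rp.
Qed.

Lemma branch_children v po us : rooted e r v po ->
  us =i [pred u | rooted e r u (Some v)] -> branch e v po = partial_branch v us.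
Proof.
move=> rv Eus; rewrite branchE //; last by case: po rv => // p /andP[].
congr (_ |: _); apply: eq_bigl => u.
by rewrite Eus [RHS](rooted_parent treeE _ rv) inE eq_sym.
Qed.

Lemma inner_has_child v po : rooted e r v po -> ~~ leaf adj v ->
  exists u, rooted e r u (Some v).
Proof.
move=> rv; case: (pickP [pred u | rooted e r u (Some v)]) => [u ru|none].
  by exists u.
case/negP; case: po rv => [p|] rv.
  rewrite /leaf (@perm_size _ _ [:: p]) //; apply: uniq_perm => // u.
  rewrite mem_adj mem_seq1; apply/idP/eqP=> [evu|->]; last by case/andP: rv.
  have := none u : rooted e r u (Some v) = false.
  by rewrite (rooted_parent treeE _ rv) evu => /negbFE/eqP[].
have : #|branch e v None| = 1.
  rewrite (branch_children (us := [::]) rv) ?partial_branch_nil ?cards1 // => u.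
  exact/esym/(none u).
by rewrite branch_root // cardsT => V1; move: V3; rewrite V1.
Qed.

(** By lists_labels_cons, whichever rule starts the list, it is completed by
    joining the remaining children one at a time. The constant 2000 is rounded up
    from the sum of the costs of the loops over the adjacency list of v. *)
Lemma process_vertex_spec par R v :
  rooted e r v (par v) -> ~~ leaf adj v ->
  (forall u, rooted e r u (Some v) -> ~~ leaf adj u ->
     label_list (R u) /\ lists_labels e (branch e u (Some v)) u (R u)) ->
  within (2000 * (size (adj v)).+1) (process_vertex adj par R v)
    (fun L => label_list L /\ lists_labels e (branch e v (par v)) v L).
Proof.
move=> rv vin Rv; set d := size (adj v).
set us0 := rev [seq u <- adj v | par v != Some u].
have us0E : us0 =i [pred u | rooted e r u (Some v)].
  by move=> u; rewrite mem_rev mem_filter mem_adj [RHS](rooted_parent treeE _ rv) andbC.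
have us0_uniq : uniq us0 by rewrite rev_uniq filter_uniq.
have us0_size : size us0 <= d by rewrite size_rev size_filter count_size.
have us0_adj : {in us0, forall u, e v u}.
  by move=> u; rewrite us0E [_ \in _](rooted_parent treeE _ rv) => /andP[].
have Rus : {in us0, forall u, ~~ leaf adj u ->
    label_list (R u) /\ lists_labels e (branch e u (Some v)) u (R u)}.
  by move=> u; rewrite us0E; apply: Rv.
have -> : branch e v (par v) = partial_branch v us0 by apply: branch_children.
apply: (@within_impl _ ((2 * d).+1 + ((3 * d).+1 + (1720 * d + 500)))).
- by lia.
- by move=> ? H; apply: H.
apply: within_bind (children_spec adj par v) _ => _ ->; rewrite -/us0.
apply: within_bind (is_support_spec adj v) _ => _ ->.
case: ifPn => [/hasP[l ladj ll]|nosupp].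
  (* The star with the leaf children first, then the other children. *)
  set lv := filter (leaf adj) us0; set ws := rev (filter (predC (leaf adj)) us0).
  have wsE : ws ++ lv =i us0.
    by move=> u; rewrite mem_cat mem_rev !mem_filter /= -andb_orl orNb.
  have lus : l \in us0.
    rewrite us0E [_ \in _](rooted_parent treeE _ rv) -mem_adj ladj /=.
    by apply: contraTneq ll => Epar; apply: (@parent_inner v); rewrite -Epar.
  apply: (@within_impl _ ((3 * size us0).+1 + (1 + (1713 * size ws).+1))).
  - have : size ws <= size us0 by rewrite size_rev size_filter count_size.
    by lia.
  - by move=> ? H; apply: H.
  apply: within_bind (split_leaves_spec adj us0) _ => _ ->; rewrite -/ws.
  have cE : (star_rule (count (leaf adj) us0)).1 = star_labels (size lv).
    rewrite size_filter; suff : 0 < count (leaf adj) us0 by case: (count _ _).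
    by rewrite -has_count; apply/hasP; exists l.
  apply: within_bind
    (@within_step _ (star_rule _).1 (fun L => L = star_labels (size lv)) cE) _.
  move=> _ ->; rewrite -(eq_partial_branch _ wsE); apply: join_children_spec.
  - rewrite cat_uniq rev_uniq !filter_uniq // andbT /=; apply/hasPn=> u.
    by rewrite mem_rev !mem_filter /= => /andP[->].
  - by move=> u; rewrite wsE; apply: us0_adj.
  - by move=> u; rewrite mem_rev mem_filter => /andP[unl uus]; apply: Rus.
  - exact: label_list_star.
  - apply: lists_labels_star; rewrite ?filter_uniq ?filter_all //.
    by move=> u; rewrite mem_filter => /andP[_ /us0_adj].
have inner u : u \in us0 -> ~~ leaf adj u.
  by move=> /us0_adj evu; apply: (hasPn nosupp); rewrite mem_adj.
have us0_neq0 : us0 != [::].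
  have [u ru] := inner_has_child rv vin.
  by apply: contraTneq ru => us00; have := us0E u; rewrite us00 /= inE => <-.
case: us0 {us0E} us0_neq0 us0_uniq us0_size us0_adj Rus inner => [//|u us] _.
move=> uniq_us size_us us_adj Rus inner.
have uin : u \in u :: us by rewrite mem_head.
have [LR xR] := Rus u uin (inner u uin).
apply: (@within_impl _ (1 + (341 + (1713 * size us).+1))).
- by move: size_us => /=; lia.
- by move=> ? H; apply: H.
apply: (@within_bind _ _ 1 _) (within_step (P := fun A => A = R u) _) _ => // _ ->.
apply: within_bind (one_vertex_rule_spec LR) _ => L [LL EL].
rewrite (@eq_partial_branch v (u :: us) (us ++ [:: u])); last first.
  by move=> w; rewrite mem_cat !inE orbC.
apply: join_children_spec => //.
- by rewrite cats1 rcons_uniq -cons_uniq.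
- by move=> w; rewrite mem_cat orbC => wP; apply: us_adj; rewrite inE -mem_seq1.
- move=> w ws; have wus : w \in u :: us by rewrite inE ws orbT.
  exact: Rus (inner w wus).
apply: (@lists_labels_eq _ _ _ _ (joined (R u) [:: -1; 0]%Z)); first by move=> a; rewrite EL.
apply: lists_labels_cons => //; last by rewrite partial_branch_nil; apply: lists_labels_set1.
by move=> w; rewrite mem_seq1 => /eqP->; apply: us_adj.
Qed.

(** * Processing all the vertices *)

Definition solved (par : V -> option V) (R : V -> seq int) (v : V) : Prop :=
  label_list (R v) /\ lists_labels e (branch e v (par v)) v (R v).

(** An internal child of an indexed vertex has a smaller index or is still in the
    bag; with an empty bag, children are processed before their parents. *)
Definition processing_order (par : V -> option V) (ord bag : seq V) : Prop :=
  [/\ uniq (ord ++ bag),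
      {in ord ++ bag, forall x, ~~ leaf adj x /\ rooted e r x (par x)} &
      forall s1 v s2 u, ord = s1 ++ v :: s2 -> rooted e r u (Some v) ->
        ~~ leaf adj u -> u \in s1 ++ bag].

(** When a vertex is processed, the lists of its internal children are complete.
    An empty list shows that its branch admits no type I set at all. *)
Lemma process_all_spec par ord R :
  processing_order par ord [::] ->
  within (\sum_(v <- ord) (2000 * (size (adj v)).+1 + 1)).+1 (process_all adj par ord R)
    (fun res => if res is Some R' then {in ord, forall v, solved par R' v}
                else exists v, forall a, ~ has_label e (branch e v (par v)) v a).
Proof.
rewrite /processing_order cats0 => -[uniq_ord ordP child_first].
suff: forall todo done R, ord = done ++ todo -> {in done, forall v, solved par R v} ->
    within (\sum_(v <- todo) (2000 * (size (adj v)).+1 + 1)).+1 (process_all adj par todo R)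
    (fun res => if res is Some R' then {in ord, forall v, solved par R' v}
                else exists v, forall a, ~ has_label e (branch e v (par v)) v a).
  by move=> H; apply: (H _ [::]).
elim=> [|v todo IH] done {}R Eord Rdone.
  by rewrite big_nil; apply: within_step; rewrite Eord cats0.
have vord : v \in ord by rewrite Eord mem_cat mem_head orbT.
have [vin rv] := ordP v vord.
rewrite big_cons -addnA -addnS.
apply: within_bind (process_vertex_spec (R := R) rv vin _) _.
  move=> u ru uin; have := child_first _ _ _ _ Eord ru uin; rewrite cats0 => ud.
  have uord : u \in ord by rewrite Eord mem_cat ud.
  have [_ rpu] := ordP u uord.
  by have := Rdone u ud; rewrite /solved (rooted_uniq treeE rpu ru).
move=> L [LL xL]; case: L LL xL => [|a L] LL xL.
  by split=> //; exists v => b /xL.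
rewrite -addnS.
apply: within_bind (@within_step _ _ (fun R' => R' = write R v (a :: L)) erefl) _ => _ ->.
apply: (IH (rcons done v)); first by rewrite cat_rcons.
move: uniq_ord; rewrite Eord cat_uniq /= negb_or => /and3P[_ /andP[vd _] _].
move=> u; rewrite mem_rcons inE /solved /write; case: eqP => [-> //|_ /= ud].
exact: Rdone.
Qed.
End Rooted.
End Algorithm.

(** * The indexing of the internal vertices *)

(** Overwriting the chosen cell with the top one and dropping the top removes
    exactly the chosen element from the bag. *)
Lemma perm_pick (T : eqType) (x : T) s i : i < (size s).+1 ->
  perm_eq (x :: s) (nth x (x :: s) i :: behead (set_nth x (x :: s) i x)).
Proof.
case: i => [|i] /=; first by [].
rewrite ltnS; elim: s i => [//|y s IH] [|i] /= si.
  exact/permEl/(perm_catCA [:: x] [:: y] s).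
have := IH i si; rewrite -(perm_cons y) => H.
apply: perm_trans (permEl (perm_catCA [:: x] [:: y] s)) _.
by apply: perm_trans H _; apply/permEl/(perm_catCA [:: y] [:: _] _).
Qed.

Section Algorithm.
Variables (V : finType) (e : rel V) (adj : V -> seq V).
Hypotheses (treeE : tree e) (adjE : adjacency_lists e adj).
Let adj_uniq v : uniq (adj v). Proof. by case: (adjE v). Qed.
Let mem_adj v u : (u \in adj v) = e v u. Proof. by case: (adjE v) => _ ->. Qed.

Variable r : V.

(** That the recorded parents are already indexed is what shows that the children
    of a vertex taken from the bag are new, so that no vertex is indexed twice. *)
Definition indexing_state (par : V -> option V) (ord bag : seq V) : Prop :=
  [/\ processing_order e adj r par ord bag, r \in ord ++ bag &
      {in ord ++ bag, forall x p, par x = Some p -> p \in ord}].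

Lemma indexing_state_step par ord bag v rest us par' :
  indexing_state par ord bag -> perm_eq bag (v :: rest) -> uniq us ->
  us =i [pred u | rooted e r u (Some v)] ->
  (forall x, par' x = if x \in us then Some v else par x) ->
  indexing_state par' (v :: ord) (rev (filter (predC (leaf adj)) us) ++ rest).
Proof.
move=> [[uniq_ob obP child_first] rob obpar] bagE uniq_us usE par'E.
set ws := rev _.
have mem_ob : ord ++ bag =i v :: ord ++ rest.
  by move=> x; rewrite mem_cat (perm_mem bagE) !inE mem_cat orbCA.
have obE : perm_eq (v :: ord ++ rest) (ord ++ bag).
  rewrite perm_sym (perm_trans (y := ord ++ v :: rest)) ?perm_cat2l //.
  by rewrite -cat1s perm_catCA.
have /= /andP[v_new uniq_or] : uniq (v :: ord ++ rest) by rewrite (perm_uniq obE).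
have vord : v \notin ord by move: v_new; rewrite mem_cat negb_or => /andP[].
have [|vin rv] := obP v; first by rewrite mem_ob mem_head.
have fresh u : u \in us -> u \notin v :: ord ++ rest.
  rewrite usE => ru; apply/negP; rewrite -mem_ob => uob.
  have [_ rpu] := obP u uob.
  have := obpar u uob v; rewrite (rooted_uniq treeE rpu ru) => /(_ erefl).
  by rewrite (negbTE vord).
have mem_new x : x \in (v :: ord) ++ (ws ++ rest) ->
    x \in ws \/ x \in ord ++ bag.
  by rewrite mem_ob !(mem_cat, inE) -!orbA => /or4P[->|->|->|->]; rewrite ?orbT; auto.
have mem_ws x : x \in ws = ~~ leaf adj x && (x \in us) by rewrite mem_rev mem_filter.
have newP x : x \in (v :: ord) ++ (ws ++ rest) ->
    ~~ leaf adj x /\ rooted e r x (par' x).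
  move=> /mem_new xP; rewrite par'E; case: ifPn => xus.
    split; last by rewrite usE in xus.
    case: xP => [|/obP[]] //; by rewrite mem_ws => /andP[].
  by case: xP => [|/obP//]; rewrite mem_ws (negbTE xus) andbF.
split=> [||x /mem_new xP p].
- split=> //.
    rewrite (perm_uniq (_ : perm_eq _ (ws ++ (v :: ord ++ rest)))); last first.
      by rewrite -!cat_cons perm_catCA.
    rewrite cat_uniq rev_uniq filter_uniq // cons_uniq v_new uniq_or !andbT andTb.
    by apply/hasPn=> x; apply: contraL => /[!mem_ws]/andP[_ /fresh].
  case=> [|w s1] x s2 u /=.
    case=> <- _ ru ul; have uus : u \in us by rewrite usE.
    by rewrite mem_cat mem_ws ul uus.
  case=> <- Eord ru ul; have := child_first _ _ _ _ Eord ru ul.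
  rewrite !(mem_cat, inE) (perm_mem bagE) inE.
  by case/or3P=> ->; rewrite ?orbT.
- move: rob; rewrite mem_ob !(mem_cat, inE) => /or3P[->|->|->]; rewrite ?orbT //.
rewrite par'E inE; case: ifPn => xus; first by case=> ->; rewrite eqxx.
case: xP => [|xob /(obpar x xob) ->]; last by rewrite orbT.
by rewrite mem_ws (negbTE xus) andbF.
Qed.

(** Each round moves one vertex out of the complement of ord and pays for its
    degree, so the cost left is a sum over that complement. There are enough
    rounds because indexed vertices are distinct. *)
Lemma index_internal_spec pick rounds par ord bag :
  indexing_state par ord bag -> #|V| <= size rounds + size ord ->
  within (\sum_(v | v \notin ord) 8 * (size (adj v)).+1).+1
    (index_internal adj pick rounds par ord bag)
    (fun po => indexing_state po.1 po.2 [::]).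
Proof.
elim: rounds par ord bag => [|y rounds IH] par ord [|x s] st /=; rewrite ?add0n => V_le.
- exact: within_step.
(* Out of rounds, all vertices would be indexed and the bag empty. *)
- have [[+ _ _] _ _] := st; rewrite -cat_rcons => /card_uniqP Eu.
  have := max_card (mem (rcons ord x ++ s)); rewrite Eu size_cat size_rcons.
  by rewrite leqNgt addSn ltnS (leq_trans V_le) ?leq_addr.
- exact: within_step.
have bagE := perm_pick x (ltn_ord (pick x s)).
move: bagE; set v := nth _ _ _; set rest := behead _ => bagE.
have [[uniq_ob obP _] _ _] := st.
have vob : v \in ord ++ x :: s by rewrite mem_cat (perm_mem bagE) mem_head orbT.
have [vin rv] := obP v vob.
have vord : v \notin ord.
  move: uniq_ob; rewrite cat_uniq => /and3P[_ /hasPn H _]; apply: H.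
  by rewrite (perm_mem bagE) mem_head.
rewrite (bigD1 v) //=.
set d := size (adj v); set W := \sum_(_ | _) _.
apply: (@within_impl _ (1 + (1 + ((2 * d).+1 + ((4 * d).+1 + W.+1)))) _ _
   (fun po => indexing_state po.1 po.2 [::])) => //; first by lia.
apply: (@within_bind _ _ 1 _ _ _ (fun a => a = v)) => // _ ->.
apply: (@within_bind _ _ 1 _ _ _ (fun a => a = rest)) => // _ ->.
apply: within_bind (children_spec adj par v) _ => us usE.
have uniq_us : uniq us by rewrite usE rev_uniq filter_uniq.
have mem_us : us =i [pred u | rooted e r u (Some v)].
  by move=> u; rewrite usE mem_rev mem_filter mem_adj [RHS](rooted_parent treeE _ rv) andbC.
have size_us : size us <= d by rewrite usE size_rev size_filter count_size.
apply: (@within_bind _ _ _ _ _ _ (fun pb =>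
   (forall x, pb.1 x = if x \in us then Some v else par x) /\
   pb.2 = rev (filter (predC (leaf adj)) us) ++ rest)).
  apply: (@within_for_each_le _ _ d 3 (fun done pb =>
    (forall x, pb.1 x = if x \in done then Some v else par x) /\
    pb.2 = rev (filter (predC (leaf adj)) done) ++ rest)) => //.
  move=> done u us' pb _ [pb1 pb2].
  apply: (@within_bind _ _ 1 2 _ _ (fun a => a = write pb.1 u (Some v))) => // _ ->.
  apply: (@within_bind _ _ 1 1) (within_is_leaf adj u) _ => _ ->.
  apply: within_step; split=> [z|] /=.
    by rewrite mem_rcons inE /write; case: eqP.
  by rewrite filter_rcons /= pb2; case: (leaf adj u); rewrite //= rev_rcons.
move=> [par' bag'] /= [par'E ->].
have st' := indexing_state_step st bagE uniq_us mem_us par'E.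
have -> : W = \sum_(w | w \notin v :: ord) 8 * (size (adj w)).+1.
  by apply: eq_bigl => w; rewrite inE negb_or andbC.
by apply: IH => //=; rewrite addnS.
Qed.

End Algorithm.

(** * Correctness and running time of the algorithm *)

Lemma small_tree (V : finType) (e : rel V) : tree e -> #|V| <= 2 ->
  exists S : {set V}, independent_12_set e S.
Proof.
case=> /card_gt0P[x _] e_sym e_irr e_conn _ V2; exists [set x].
split=> [y z|y]; first by rewrite !inE => /eqP-> /eqP->; rewrite e_irr.
rewrite inE => yx; have -> : neighbors e y :&: [set x] = [set x].
  apply/setIidPr; rewrite sub1set inE.
  have /connectP[[|z p] /= pyx Ex] := e_conn y x; first by rewrite Ex eqxx in yx.
  have /andP[eyz _] := pyx.
  have [<-//|zx] := eqVneq z x.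
  have : uniq [:: x; y; z].
    rewrite /= !inE negb_or ![x == _]eq_sym yx zx !andbT /=.
    by apply: contraTneq eyz => ->; rewrite e_irr.
  by move/card_uniqP => E3; have := max_card (mem [:: x; y; z]); rewrite E3 leqNgt ltnS V2.
by rewrite cards1.
Qed.

(** If all vertices had degree one, then a vertex and its neighbour would form a
    component. *)
Lemma exists_inner (V : finType) (e : rel V) (adj : V -> seq V) :
  tree e -> adjacency_lists e adj -> 2 < #|V| -> exists v, ~~ leaf adj v.
Proof.
move=> treeE adjE V3; case: (pickP (fun v => ~~ leaf adj v)) => [v vl|all_leaf].
  by exists v.
have mem_adj u w : (w \in adj u) = e u w by case: (adjE u) => _ ->.
have nbr u : exists w, forall z, e u z = (z == w).
  have /negbFE := all_leaf u; rewrite /leaf; case E: (adj u) => [|w []] // _.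
  by exists w => z; rewrite -mem_adj E mem_seq1.
have [/card_gt0P[x _] e_sym e_irr _ _] := treeE.
have [w xw] := nbr x; have [x' wx'] := nbr w.
have Ex' : x' = x by have := xw w; rewrite eqxx e_sym wx' => /eqP.
have : [set x; w] = setT.
  apply: (closed_full treeE (set21 x w)) => y z /set2P[]->.
    by rewrite xw !inE orbC => ->.
  by rewrite wx' Ex' !inE => ->.
move/(congr1 (fun A : {set V} => #|A|)); rewrite cardsT cards2 => E.
by move: V3; rewrite -E; case: eqP.
Qed.

Theorem theorem4 :
  exists C : nat,
  forall (V : finType) (e : rel V) (adj : V -> seq V) (vs : seq V)
    (pick : chooser V),
  tree e -> adjacency_lists e adj -> vertex_list vs ->
  ((tree_independent_12_set adj pick vs).1 <->
     exists S : {set V}, independent_12_set e S) /\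
  (tree_independent_12_set adj pick vs).2 <= C * #|V|.
Proof.
exists (2000 * 3 + 100) => V e adj vs pick treeE adjE [uniq_vs mem_vs].
have size_vs : size vs = #|V|.
  by rewrite -(card_uniqP uniq_vs); apply: eq_card => x; rewrite mem_vs.
suff [tm res] : within ((2000 * 3 + 100) * #|V|)
    (tree_independent_12_set adj pick vs)
    (fun b => b <-> exists S : {set V}, independent_12_set e S) by [].
have V0 : 0 < #|V| by case: treeE.
rewrite /tree_independent_12_set.
have [V2|V3] := leqP #|V| 2.
  have small := small_tree treeE V2.
  have : within ((2000 * 3 + 100) * #|V|) (step true)
      (fun b => b <-> exists S, independent_12_set e S).
    by split=> //=; rewrite muln_gt0 V0.
  by case: vs {mem_vs uniq_vs} size_vs => [|? [|? [|? ?]]] //= E; move: V2; rewrite -E.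
case: vs size_vs mem_vs uniq_vs => [|a [|b [|c vs']]] size_vs mem_vs _;
  try by move: V3; rewrite -size_vs.
move: size_vs mem_vs; set vs := [:: _, _, _ & _] => size_vs mem_vs.
have sum_deg : \sum_(v : V) (size (adj v)).+1 <= 3 * #|V|.
  rewrite (eq_bigr (fun v => #|neighbors e v| + 1)); last first.
    by move=> v _; rewrite (size_adj adjE) addn1.
  rewrite big_split /= sum1_card (mulnDl 2 1) mul1n.
  exact: leq_add (sum_degrees treeE) (leqnn _).
set n := #|V| in size_vs V0 V3 sum_deg *.
have array A (x : A) :
    within (2 * n).+1 (new_array vs x) (fun f => forall v, f v = x).
  by rewrite -size_vs; apply: new_array_spec.
(* In order: search of the root, parent array, indexing, label array,
   processing, final test. The factor 3 in 24 = 8 * 3 and in 2000 * 3 is that of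
   sum_deg. *)
apply: (@within_impl _ ((2 * n).+1 + ((2 * n).+1 + ((24 * n).+1 +
    ((2 * n).+1 + (((2000 * 3 + 1) * n).+1 + 11)))))).
- by move: (n) V0 => k k0; lia.
- by move=> ? H; apply: H.
have := find_non_leaf_spec adj vs; rewrite size_vs => find.
apply: within_bind find _ => -[r|] r_inner; last first.
  by have [v] := exists_inner treeE adjE V3; rewrite (allP r_inner).
apply: within_bind (array _ None) _ => par0 par0E.
have st0 : indexing_state e adj r par0 [::] [:: r].
  split=> [||x _ p]; [|by rewrite mem_head|by rewrite par0E].
  split=> [//|x|[]//].
  by rewrite mem_seq1 => /eqP->; rewrite par0E /= eqxx.
have := @index_internal_spec V e adj treeE adjE r pick vs par0 [::] [:: r] st0.
rewrite size_vs addn0 => /(_ (leqnn _)) idx.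
apply: within_bind (_ : within (24 * n).+1 _ _) _.
  apply: within_impl idx; [|by move=> ? H; apply: H].
  rewrite ltnS -big_distrr /= (eq_bigl xpredT) // -[24]/(8 * 3) -mulnA.
  by rewrite leq_mul2l sum_deg orbT.
move=> [par ord] [[uniq_ord ordP first] rord _].
rewrite cats0 in rord.
apply: within_bind (array _ [::]) _ => R0 _.
have po : processing_order e adj r par ord [::] by [].
have := process_all_spec treeE adjE V3 r_inner R0 po => proc.
have parr : par r = None.
  have [|_ rr] := ordP r; first by rewrite cats0.
  by apply: (rooted_uniq treeE rr); rewrite /= eqxx.
apply: within_bind (_ : within ((2000 * 3 + 1) * n).+1 _ _) _.
  apply: within_impl proc; [|by move=> ? H; apply: H].
  rewrite ltnS; rewrite cats0 in uniq_ord; rewrite big_uniq //=.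
  apply: leq_trans (_ : \sum_v (2000 * (size (adj v)).+1 + 1) <= _).
    by rewrite [leqRHS](bigID (mem ord)) leq_addr.
  rewrite big_split /= sum1_card -big_distrr /= mulnDl mul1n -mulnA.
  by apply: leq_add => //; rewrite leq_mul2l sum_deg orbT.
case=> [R|] /=; last first.
  move=> [v noS]; split=> //; split=> // -[S iS].
  set B := branch e v (par v) in noS.
  case: (noS (label e B v (S :&: B))); exists (S :&: B) => //.
  exact: independent_type_I.
move=> /(_ r rord)[LR]; rewrite parr => xR.
pose yes_label (d : int) := d \in [:: 0; 1; 2]%Z.
apply: (@within_impl _ 11 11 _ (fun b => b = has yes_label (R r))) => //.
  move=> _ ->; rewrite (independent_label treeE r).
  split=> [/hasP[d dR d012]|[d d012 /xR dR]].
    by exists d => //; apply/xR.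
  by apply/hasP; exists d.
apply: (@within_for_each_le _ _ 5 1 (fun done b => b = has yes_label done)) => //.
  exact: label_list_size.
by move=> done d rest b' _ ->; apply: within_step; rewrite has_rcons orbC.
Qed.
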